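(* Let $\mathrm{OPT}_{\mathrm{DSRSE}}$ and $\mathrm{OPT}_{\mathrm{CDSRSE}}$ be the optimal values (maximum expected total weight over all policies) of DSRSE and CDSRSE on the same instance, and let $\mu_{\mathrm{pes}}$ be an optimal solution of the linear program $\min\{\sum_{r=1}^m\mu_r:\ \sum_{r=a_i}^{d_i}\mu_r\ge w_i\ \forall i\in N,\ \mu\ge0\}$. Then $$\sum_{r=1}^m[\mu_{\mathrm{pes}}]_r\ \le\ \mathrm{OPT}_{\mathrm{CDSRSE}}\ \le\ \mathrm{OPT}_{\mathrm{DSRSE}}\ \le\ \sum_{r=1}^m[\mu_{\mathrm{pes}}]_r\left(1+\sum_{i:\,a_i\le r\le b_i}(1-P^o_{ir})+\sum_{i:\,c_i\le r\le d_i}(1-P^o_{ir})\right).$$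
   Context: An instance consists of slots $M=[m]=\{1,\dots,m\}$, tasks $N=[n]$, weights $w\in\mathbb{R}_+^N$, and for each task $i\in N$ independent discrete distributions $D_i^s,D_i^e$ of its start time $s_i$ and end time $e_i$ in $M$, with supports $S_i,E_i\subseteq M$ satisfying $\max S_i\le\min E_i$; times of different tasks are independent. If scheduled, task $i$ occupies all slots of $[s_i,e_i]$; two tasks conflict if they occupy a common slot. Put $a_i=\min S_i$, $b_i=\max S_i$, $c_i=\min E_i$, $d_i=\max E_i$, and $P^o_{ik}=\Pr[s_i\le k\le e_i]$ (under the original distributions). DSRSE (dynamic scheduling with random start and end times): the scheduler commits to tasks one at a time, adaptively. When an available task $i$ is committed (scheduled), it earns weight $w_i$, and its times $s_i,e_i$ are realized according to its current distribution. For every other remaining task $j$, let $p_{ij}$ be the probability, under $j$'s current distribution, that $[s_j,e_j]$ intersects the realized interval $[s_i,e_i]$; draw (independently for distinct $j$) $B_{ij}\sim\mathrm{Bernoulli}(p_{ij})$. If $B_{ij}=1$, task $j$ is deleted; otherwise $j$ remains available and its (joint) distribution of $(s_j,e_j)$ is updated by conditioning on not conflicting with the slots $[s_i,e_i]$. The process ends when no task is available. The objective is to maximize the expected total weight of scheduled tasks. CDSRSE (conservative version): the same, except that after $i$ is committed and $s_i,e_i$ are realized according to $D_i^s,D_i^e$, every remaining task $j$ that possibly conflicts with $i$, i.e. for which some slot that $j$ occupies with positive probability lies in $[s_i,e_i]$, is deleted, and all other remaining tasks are kept with unchanged distributions. *)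

(* Defs.v *)
From mathcomp Require Import all_boot all_order all_algebra.
From mathcomp Require Import classical_sets reals.

Set Implicit Arguments.
Unset Strict Implicit.
Unset Printing Implicit Defensive.

Import Order.TTheory GRing.Theory Num.Theory.

Local Open Scope ring_scope.

Record distr (R : realType) (T : finType) := Distr {
  distr_fun :> T -> R;
  distr_ge0 : forall x, 0 <= distr_fun x;
  distr_sum1 : \sum_x distr_fun x = 1 }.

Definition distr_support (R : realType) (T : finType) (D : distr R T) : {set T} :=
  [set x | D x != 0].

(* The default value m is never attained by an element of 'I_m; it is
   irrelevant for the support of a distribution, which is nonempty. *)
Definition min_slot (m : nat) (K : {set 'I_m}) : nat := \big[minn/m]_(k in K) k.

Definition max_slot (m : nat) (K : {set 'I_m}) : nat := \max_(k in K) k.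

(* Slots and tasks are numbered from 0: M = 'I_m and N = 'I_n. *)
Record instance (R : realType) (m n : nat) := Instance {
  weight : 'I_n -> R;
  start_distr : 'I_n -> distr R 'I_m;
  end_distr : 'I_n -> distr R 'I_m;
  weight_ge0 : forall i, 0 <= weight i;
  start_le_end : forall i,
    (max_slot (distr_support (start_distr i))
       <= min_slot (distr_support (end_distr i)))%N }.

(* Realized times of a task: (start slot, end slot). *)
Definition times (m : nat) : finType := ('I_m * 'I_m)%type.

Definition slots (m : nat) (t : times m) : {set 'I_m} :=
  [set k : 'I_m | (t.1 <= k <= t.2)%N].

Definition conflict (m : nat) (t u : times m) : bool :=
  ~~ [disjoint slots t & slots u].

(* Joint laws are plain functions, because the conditional law given an event
   of probability 0, which is only met with probability 0, need not be
   normalized. *)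
Definition joint_law (R : realType) (m n : nat) : Type := 'I_n -> times m -> R.

Definition occupy_prob (R : realType) (m n : nat) (Q : joint_law R m n)
    (i : 'I_n) (k : 'I_m) : R :=
  \sum_(t | k \in slots t) Q i t.

Definition conflict_prob (R : realType) (m n : nat) (Q : joint_law R m n)
    (t : times m) (j : 'I_n) : R :=
  \sum_(u | conflict t u) Q j u.

Definition condition_on (R : realType) (m n : nat) (Q : joint_law R m n)
    (t : times m) : joint_law R m n :=
  fun j u => if conflict t u then 0 else Q j u / (1 - conflict_prob Q t j).

(* One round: the set of tasks that were available, the task that was
   committed, and its realized times. *)
Definition round (m n : nat) : Type := ({set 'I_n} * 'I_n * times m)%type.

(* Policies may depend on the whole history and may randomize: given the past
   rounds h and the available tasks A, task i is committed with probability
   commit_prob h A i. *)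
Record policy (R : realType) (m n : nat) := Policy {
  commit_prob : seq (round m n) -> {set 'I_n} -> 'I_n -> R;
  commit_prob_ge0 : forall h A i, 0 <= commit_prob h A i;
  commit_prob_available : forall h (A : {set 'I_n}) i,
    i \notin A -> commit_prob h A i = 0;
  commit_prob_sum1 : forall h (A : {set 'I_n}), A != finset.set0 ->
    \sum_(i in A) commit_prob h A i = 1 }.

Section Scheduling.

Variables (R : realType) (m n : nat) (I : instance R m n).

Definition a_ (i : 'I_n) : nat := min_slot (distr_support (start_distr I i)).
Definition b_ (i : 'I_n) : nat := max_slot (distr_support (start_distr I i)).
Definition c_ (i : 'I_n) : nat := min_slot (distr_support (end_distr I i)).
Definition d_ (i : 'I_n) : nat := max_slot (distr_support (end_distr I i)).

Definition initial_law : joint_law R m n :=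
  fun i t => start_distr I i t.1 * end_distr I i t.2.

Definition Po (i : 'I_n) (k : 'I_m) : R := occupy_prob initial_law i k.

(* Probability that exactly the tasks of A' survive among those of A when the
   task i is committed with realized times t: the events B_ij = 0 (j in A')
   and B_ij = 1 (other j) are independent. *)
Definition survival_prob (Q : joint_law R m n) (A : {set 'I_n}) (i : 'I_n)
    (t : times m) (A' : {set 'I_n}) : R :=
  \prod_(j in A') (1 - conflict_prob Q t j) *
  \prod_(j in (A :\ i) :\: A') conflict_prob Q t j.

(* Expected total weight collected by pi in at most k further rounds of DSRSE,
   from history h, available tasks A and current laws Q. Every round consumes
   at least the committed task, so n rounds always exhaust the process. *)
Fixpoint dsrse_gain (pi : policy R m n) (k : nat) (h : seq (round m n))
    (A : {set 'I_n}) (Q : joint_law R m n) : R :=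
  if k is k'.+1 then
    \sum_(i in A) commit_prob pi h A i *
      (weight I i +
       \sum_t Q i t *
         \sum_(A' in powerset (A :\ i)) survival_prob Q A i t A' *
           dsrse_gain pi k' (rcons h (A, i, t)) A' (condition_on Q t))
  else 0.

Definition possible_conflict (t : times m) (j : 'I_n) : bool :=
  [exists k : 'I_m, (k \in slots t) && (0 < Po j k)].

(* Same as dsrse_gain, for CDSRSE: the laws never change. *)
Fixpoint cdsrse_gain (pi : policy R m n) (k : nat) (h : seq (round m n))
    (A : {set 'I_n}) : R :=
  if k is k'.+1 then
    \sum_(i in A) commit_prob pi h A i *
      (weight I i +
       \sum_t initial_law i t *
         cdsrse_gain pi k' (rcons h (A, i, t))
           [set j in A :\ i | ~~ possible_conflict t j])
  else 0.

(* Both suprema are over nonempty sets bounded by the total weight, and are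
   attained because there are finitely many reachable histories. *)
Definition OPT_DSRSE : R :=
  sup (range (fun pi => dsrse_gain pi n [::] [set: 'I_n] initial_law)).

Definition OPT_CDSRSE : R :=
  sup (range (fun pi => cdsrse_gain pi n [::] [set: 'I_n])).

Definition pes_feasible (mu : 'I_m -> R) : Prop :=
  (forall r, 0 <= mu r) /\
  (forall i, weight I i <= \sum_(r < m | (a_ i <= r <= d_ i)%N) mu r).

Definition pes_optimal (mu : 'I_m -> R) : Prop :=
  pes_feasible mu /\
  (forall nu, pes_feasible nu -> \sum_r mu r <= \sum_r nu r).

End Scheduling.

(* Main.v *)
(** For the lower bound, let [packing_value r] be the maximum weight of a set of
tasks whose spans [[a_i, d_i]] are pairwise disjoint and end before slot [r].
Its increments are feasible for the linear program, so the optimum of the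
program is at most the weight of a best packing; a CDSRSE policy that gives
priority to the tasks of that packing collects all of them. In DSRSE a policy
can simulate any CDSRSE policy, because the tasks which CDSRSE would keep are
not affected by the committed ones.

For the upper bound, charge [w_i <= \sum_(a_i <= r <= d_i) mu_r] to the slots.
The tasks charged to [r] which occupy [r] are at most one in number, since
committed tasks do not conflict. A task charged to [r] which does not occupy [r]
contributes at most its initial probability of not occupying [r]: the survival
probability times the updated law is at most the original law. *)

Require Import Defs.
From mathcomp Require Import classical_sets reals.
From mathcomp Require Import all_boot all_order all_algebra.

Set Implicit Arguments.
Unset Strict Implicit.
Unset Printing Implicit Defensive.

Import Order.TTheory GRing.Theory Num.Theory.

Local Open Scope ring_scope.

(** * Expansion of products over subsets *)

(** Extending [f] by 0 and [g] by 1 outside [B] gives the expansion over all subsets of [T], where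
    those not inside [B] vanish. *)
Lemma sum_powerset_prod (R : comNzRingType) (T : finType) (B : {set T})
    (f g : T -> R) :
  \sum_(A in powerset B) (\prod_(j in A) f j * \prod_(j in B :\: A) g j) =
    \prod_(j in B) (f j + g j).
Proof.
pose F j := if j \in B then f j else 0.
pose G j := if j \in B then g j else 1.
have -> : \prod_(j in B) (f j + g j) = \prod_j (F j + G j).
  rewrite big_mkcond; apply: eq_bigr => j _; rewrite /F /G.
  by case: ifP; rewrite ?add0r.
rewrite bigA_distr [LHS]big_mkcond; apply: eq_bigr => A _.
rewrite powersetE; case: ifPn => [sAB|/subsetPn[j jA jB]]; last first.
  by rewrite (bigD1 j) //= jA /F (negPf jB) mul0r.
rewrite [RHS](bigID [in A]) /=. congr (_ * _).
  by apply: eq_bigr => j jA; rewrite jA /F (subsetP sAB).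
rewrite [LHS]big_mkcond [RHS]big_mkcond; apply: eq_bigr => j _.
by rewrite !inE /G; case: (j \in A); case: (j \in B).
Qed.

(** Replacing [g] by 0 at [j] kills the subsets without [j]; every factor of the resulting product
    except [f j] is 1. *)
Lemma sum_powerset_prod_mem (R : comNzRingType) (T : finType) (B : {set T})
    (f g : T -> R) (j : T) :
  j \in B -> (forall i, f i + g i = 1) ->
  \sum_(A in powerset B | j \in A)
     (\prod_(i in A) f i * \prod_(i in B :\: A) g i) = f j.
Proof.
move=> jB fg1; pose g' i := if i == j then 0 else g i.
transitivity (\prod_(i in B) (f i + g' i)); last first.
  rewrite (bigD1 j) //= /g' eqxx addr0 big1 ?mulr1 // => i /andP[_ /negPf ->].
  exact: fg1.
rewrite -sum_powerset_prod big_mkcondr /=; apply: eq_bigr => A.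
rewrite powersetE => sAB; case: ifPn => jA; last first.
  by rewrite [X in _ * X](bigD1 j) /g' ?inE ?jA //= eqxx mul0r mulr0.
congr (_ * _); apply: eq_bigr => i; rewrite /g' !inE.
by case: eqP => // ->; rewrite jA.
Qed.

(** * Extreme slots and supports *)

Lemma min_slot_le (m : nat) (K : {set 'I_m}) (k : 'I_m) :
  k \in K -> (min_slot K <= k)%N.
Proof.
rewrite /min_slot; have := mem_index_enum k.
elim: (index_enum _) => // x s IH; rewrite inE big_cons => /orP[/eqP <- ->|].
  exact: geq_minl.
by move=> /IH{}IH /IH{}IH; case: ifP => // _; rewrite geq_min IH orbT.
Qed.

Lemma le_max_slot (m : nat) (K : {set 'I_m}) (k : 'I_m) :
  k \in K -> (k <= max_slot K)%N.
Proof. by move=> kK; rewrite /max_slot (bigD1 k) //= leq_maxl. Qed.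

Lemma max_slot_lt (m : nat) (K : {set 'I_m}) : (0 < m)%N -> (max_slot K < m)%N.
Proof.
move=> m_gt0; rewrite /max_slot; elim/big_ind: _ => // x y xm ym.
by rewrite gtn_max xm ym.
Qed.

Lemma distr_support_neq0 (R : realType) (T : finType) (D : distr R T) :
  exists x, x \in distr_support D.
Proof.
have [D0|[x xD]] := set_0Vmem (distr_support D); last by exists x.
have := distr_sum1 D; rewrite big1 => [/esym/eqP|x _]; first by rewrite oner_eq0.
by move/setP/(_ x): D0; rewrite !inE => /negbFE/eqP.
Qed.

(** * Conditioned laws and survival of tasks *)

Section Laws.

Variables (R : realType) (m n : nat) (I : instance R m n).

(** Normalization is stated task by task, since conditioning loses it for a task whose conflict
    probability is 1. *)
Definition proper_law (Q : joint_law R m n) (j : 'I_n) : Prop :=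
  (forall u, 0 <= Q j u) /\ \sum_u Q j u = 1.

Lemma initial_law_proper j : proper_law (initial_law I) j.
Proof.
split=> [u|]; first by rewrite /initial_law mulr_ge0 ?distr_ge0.
rewrite -(pair_bigA _ (fun s e => start_distr I j s * end_distr I j e)) /=.
under eq_bigr do rewrite -mulr_sumr distr_sum1 mulr1.
exact: distr_sum1.
Qed.

Lemma conflict_prob_ge0 Q t j : proper_law Q j -> 0 <= conflict_prob Q t j.
Proof. by case=> Q0 _; apply: sumr_ge0. Qed.

Lemma sum_no_conflict Q t j :
  proper_law Q j -> \sum_(u | ~~ conflict t u) Q j u = 1 - conflict_prob Q t j.
Proof. by case=> _ <-; rewrite [in RHS](bigID (conflict t)) /= addrAC subrr add0r. Qed.

Lemma conflict_prob_le1 Q t j : proper_law Q j -> conflict_prob Q t j <= 1.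
Proof.
move=> Qj; rewrite -subr_ge0 -sum_no_conflict //.
by case: Qj => Q0 _; apply: sumr_ge0.
Qed.

Lemma condition_on_proper Q t j :
  proper_law Q j -> conflict_prob Q t j != 1 ->
  proper_law (condition_on Q t) j.
Proof.
move=> Qj p1; split=> [u|]; rewrite /condition_on.
  case: ifP => // _; rewrite divr_ge0 ?subr_ge0 ?conflict_prob_le1 //.
  by case: Qj.
rewrite (bigID (conflict t)) /= big1 ?add0r => [|u -> //].
transitivity (\sum_(u | ~~ conflict t u) Q j u / (1 - conflict_prob Q t j)).
  by apply: eq_bigr => u /negPf ->.
by rewrite -mulr_suml sum_no_conflict // divff // subr_eq0 eq_sym.
Qed.

Section Survival.

Variables (Q : joint_law R m n) (A : {set 'I_n}) (i : 'I_n) (t : times m).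
Hypothesis Q_proper : forall j, j \in A -> proper_law Q j.

Lemma survival_prob_ge0 (A' : {set 'I_n}) :
  A' \in powerset (A :\ i) -> 0 <= survival_prob Q A i t A'.
Proof.
rewrite powersetE => sA'; apply: mulr_ge0; apply: prodr_ge0 => j.
  move=> /(subsetP sA'); rewrite !inE => /andP[_ jA].
  by rewrite subr_ge0 (conflict_prob_le1 _ (Q_proper jA)).
by rewrite !inE => /and3P[_ _ jA]; rewrite (conflict_prob_ge0 _ (Q_proper jA)).
Qed.

(** A task that surely conflicts has factor 0 when it survives, so on outcomes of nonzero
    probability the survivors can be conditioned. *)
Lemma survival_prob_proper (A' : {set 'I_n}) j :
  A' \in powerset (A :\ i) -> survival_prob Q A i t A' != 0 -> j \in A' ->
  proper_law (condition_on Q t) j.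
Proof.
rewrite powersetE => sA' s0 jA'; apply: condition_on_proper.
  by apply: Q_proper; move: (subsetP sA' _ jA'); rewrite !inE => /andP[].
apply: contraNneq s0 => pj; rewrite /survival_prob (bigD1 j) //=.
by rewrite pj subrr !mul0r.
Qed.

(** Deleting a task of conflict probability 0 puts a factor 0 into the product. *)
Lemma survival_prob_certain (A' : {set 'I_n}) j :
  survival_prob Q A i t A' != 0 -> j \in A :\ i ->
  conflict_prob Q t j = 0 -> j \in A'.
Proof.
move=> s0 jA pj; apply: contraNT s0 => jA'.
have jD : j \in (A :\ i) :\: A' by rewrite in_setD jA' jA.
by rewrite /survival_prob mulrC (bigD1 j jD) /= pj !mul0r.
Qed.

Lemma sum_survival_prob :
  \sum_(A' in powerset (A :\ i)) survival_prob Q A i t A' = 1.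
Proof. by rewrite sum_powerset_prod big1 // => j _; rewrite subrK. Qed.

Lemma sum_survival_prob_mem j : j \in A :\ i ->
  \sum_(A' in powerset (A :\ i) | j \in A') survival_prob Q A i t A' =
    1 - conflict_prob Q t j.
Proof.
move=> jA; rewrite (sum_powerset_prod_mem (g := conflict_prob Q t) jA) // => l.
by rewrite subrK.
Qed.

End Survival.

End Laws.

(** * Upper bound by a potential at each slot *)

Section UpperBound.

Variables (R : realType) (m n : nat) (I : instance R m n).

Definition vacancy_prob (Q : joint_law R m n) (r : 'I_m) (j : 'I_n) : R :=
  \sum_(u | r \notin slots u) Q j u.

Lemma vacancy_prob_ge0 Q r j : proper_law Q j -> 0 <= vacancy_prob Q r j.
Proof. by case=> Q0 _; apply: sumr_ge0. Qed.

Lemma vacancy_probE Q r j :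
  proper_law Q j -> vacancy_prob Q r j = 1 - occupy_prob Q j r.
Proof.
case=> _ <-; rewrite [in RHS](bigID [pred u | r \in slots u]) /=.
by rewrite addrAC subrr add0r.
Qed.

Lemma vacancy_prob_le1 Q r j : proper_law Q j -> vacancy_prob Q r j <= 1.
Proof.
move=> Qj; rewrite vacancy_probE // lerBlDr lerDl; apply: sumr_ge0 => u _.
by case: Qj.
Qed.

Lemma vacancy_prob_eq1 Q r j :
  proper_law Q j -> (forall u, r \in slots u -> Q j u = 0) ->
  vacancy_prob Q r j = 1.
Proof. by move=> Qj Q0; rewrite vacancy_probE // /occupy_prob big1 ?subr0. Qed.

(** The factor is the normalizing constant of the conditional law, so each term is either unchanged
    or 0. *)
Lemma condition_on_vacancy Q t r j : proper_law Q j ->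
  (1 - conflict_prob Q t j) * vacancy_prob (condition_on Q t) r j <=
    vacancy_prob Q r j.
Proof.
move=> Qj; rewrite mulr_sumr; apply: ler_sum => u _; rewrite /condition_on.
have Q0 : 0 <= Q j u by case: Qj.
case: ifP => _; first by rewrite mulr0.
have [->|p1] := eqVneq (1 - conflict_prob Q t j) 0; first by rewrite mul0r.
by rewrite mulrC divfK.
Qed.

(** After the sums are exchanged, each task is weighted by its survival probability, which cancels
    the normalization of its updated law. *)
Lemma expected_vacancy Q (A : {set 'I_n}) i t r (P : pred 'I_n) :
  (forall j, j \in A -> proper_law Q j) ->
  \sum_(A' in powerset (A :\ i)) survival_prob Q A i t A' *
      \sum_(j in A' | P j) vacancy_prob (condition_on Q t) r j <=
    \sum_(j in A :\ i | P j) vacancy_prob Q r j.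
Proof.
move=> QA; under eq_bigr do rewrite mulr_sumr.
rewrite (exchange_big_dep [pred j | (j \in A :\ i) && P j]) /=; last first.
  move=> A' j; rewrite powersetE => sA' /andP[jA' ->].
  by rewrite (subsetP sA').
apply: ler_sum => j /andP[jA Pj].
under eq_bigl do rewrite Pj andbT.
rewrite -mulr_suml sum_survival_prob_mem //; apply: condition_on_vacancy.
by apply: QA; move: jA; rewrite !inE => /andP[].
Qed.

(* Bounds the expected number of tasks charged to r from now on; b tells
   whether r is still unoccupied. *)
Definition potential (b : bool) (Q : joint_law R m n) (A : {set 'I_n})
    (r : 'I_m) : R :=
  b%:R + \sum_(j in A | (a_ I j <= r <= d_ I j)%N) vacancy_prob Q r j.

Lemma potential_ge0 b Q (A : {set 'I_n}) r :
  (forall j, j \in A -> proper_law Q j) -> 0 <= potential b Q A r.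
Proof.
move=> QA; rewrite addr_ge0 ?ler0n //; apply: sumr_ge0 => j /andP[jA _].
by apply: vacancy_prob_ge0; apply: QA.
Qed.

(** Committing [i] to a span containing [r] removes its vacancy summand. While [r] is unoccupied,
    the flag pays the charge and this summand pays for the chance that the flag stays up; once [r]
    is occupied, the summand is 1 and pays the charge itself. *)
Lemma potential_step b Q (A : {set 'I_n}) r i :
  (forall j, j \in A -> proper_law Q j) ->
  (~~ b -> forall j u, j \in A -> r \in slots u -> Q j u = 0) ->
  i \in A ->
  (a_ I i <= r <= d_ I i)%N%:R +
    \sum_t Q i t * \sum_(A' in powerset (A :\ i)) survival_prob Q A i t A' *
      potential (b && (r \notin slots t)) (condition_on Q t) A' r <=
  potential b Q A r.
Proof.
move=> QA Q0 iA; have Qi := QA _ iA.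
set X := \sum_(j in A :\ i | (a_ I j <= r <= d_ I j)%N) vacancy_prob Q r j.
have stepE t : \sum_(A' in powerset (A :\ i)) survival_prob Q A i t A' *
      potential (b && (r \notin slots t)) (condition_on Q t) A' r <=
    (b && (r \notin slots t))%:R + X.
  under eq_bigr do rewrite mulrDr.
  by rewrite big_split -mulr_suml sum_survival_prob mul1r lerD2l expected_vacancy.
have : \sum_t Q i t * \sum_(A' in powerset (A :\ i))
      survival_prob Q A i t A' *
      potential (b && (r \notin slots t)) (condition_on Q t) A' r <=
    b%:R * vacancy_prob Q r i + X.
  apply: (le_trans (y := \sum_t Q i t * ((b && (r \notin slots t))%:R + X))).
    by apply: ler_sum => t _; apply: ler_wpM2l => //; case: Qi.
  under eq_bigr do rewrite mulrDr.
  rewrite big_split -mulr_suml; case: (Qi) => _ ->; rewrite mul1r lerD2r.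
  (* An unoccupied [r] stays so exactly when [t] misses it, whence the vacancy probability of
     [i]. *)
  rewrite mulr_sumr [leRHS]big_mkcond; apply: ler_sum => t _.
  by case: b {Q0 stepE}; case: ifP => _; rewrite ?mulr0 ?mulr1 ?mul0r ?mul1r.
move=> {stepE} step_le; apply: (le_trans (lerD (lexx _) step_le)).
rewrite addrA /potential.
have -> : \sum_(j in A | (a_ I j <= r <= d_ I j)%N) vacancy_prob Q r j =
    (if (a_ I i <= r <= d_ I i)%N then vacancy_prob Q r i else 0) + X.
  rewrite (bigID (pred1 i)) /=; congr (_ + _).
    case: ifPn => [ri|/negPf ri].
      rewrite (big_pred1 i) // => j /=.
        by case: eqP => [->|_]; rewrite ?iA ?ri ?andbF.
    by rewrite big_pred0 // => j /=; case: eqP => [->|_]; rewrite ?ri ?andbF.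
  by apply: eq_bigl => j; rewrite !inE; case: (j == i); rewrite ?andbF ?andbT.
rewrite addrA lerD2r; case: ifP => _ /=.
  case: b Q0 {step_le} => [_|/(_ isT) Q0]; first by rewrite mul1r.
  rewrite mul0r addr0 add0r vacancy_prob_eq1 // => u; exact: Q0.
(* Outside its span, [i] brings no charge and the flag can only drop. *)
by rewrite add0r addr0 ler_piMr ?ler0n ?vacancy_prob_le1.
Qed.

(** Induction on the rounds: the covering constraint splits the weight of [i] into charges [mu r],
    each paid by [potential_step]. The flag [b r] may be false only if no available task can still
    occupy [r]. *)
Lemma dsrse_gain_le (mu : 'I_m -> R) (pi : policy R m n) k :
  pes_feasible I mu ->
  forall h (A : {set 'I_n}) Q (b : 'I_m -> bool),
  (forall j, j \in A -> proper_law Q j) ->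
  (forall r, ~~ b r -> forall j u, j \in A -> r \in slots u -> Q j u = 0) ->
  dsrse_gain I pi k h A Q <= \sum_r mu r * potential (b r) Q A r.
Proof.
case=> mu0 mu_cover; elim: k => [|k IH] h A Q b QA Q0 /=.
  by apply: sumr_ge0 => r _; rewrite mulr_ge0 ?potential_ge0.
set Y := (leRHS).
have Y0 : 0 <= Y by apply: sumr_ge0 => r _; rewrite mulr_ge0 ?potential_ge0.
have [->|A0] := eqVneq A finset.set0; first by rewrite big_set0.
rewrite -[Y]mul1r -(commit_prob_sum1 pi h A0) mulr_suml.
apply: ler_sum => i iA; apply: ler_wpM2l; first exact: commit_prob_ge0.
have Qi := QA _ iA.
pose b' t r := b r && (r \notin slots t).
apply: (le_trans (y := \sum_(r < m) mu r * (a_ I i <= r <= d_ I i)%N%:R +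
  \sum_t Q i t * \sum_(A' in powerset (A :\ i)) survival_prob Q A i t A' *
    \sum_r mu r * potential (b' t r) (condition_on Q t) A' r)).
  apply: lerD.
    apply: le_trans (mu_cover i) _; rewrite big_mkcond; apply: ler_sum => r _.
    by case: ifP; rewrite ?mulr1 ?mulr0.
  apply: ler_sum => t _; apply: ler_wpM2l; first by case: Qi.
  (* Outcomes of probability 0 are set aside, since their updated laws may fail to be proper. *)
  apply: ler_sum => A' sA'; have [->|s0] := eqVneq (survival_prob Q A i t A') 0.
    by rewrite !mul0r.
  apply: ler_wpM2l; first exact: survival_prob_ge0.
  apply: IH => [j|r br j u jA' ru]; first exact: survival_prob_proper sA' s0.
  have jA : j \in A.
    move: sA'; rewrite powersetE => /subsetP/(_ _ jA').
    by rewrite !inE => /andP[].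
  (* Either [r] was occupied before, or [u] meets [t] at [r] and conditioning excludes [u]. *)
  rewrite /condition_on; case: ifPn => // /negbNE tu.
  move: br; rewrite /b' negb_and negbK => /orP[br|rt].
    by rewrite (Q0 r br) ?mul0r.
  by case/pred0Pn: tu; exists r; rewrite /= rt ru.
have -> : \sum_t Q i t * \sum_(A' in powerset (A :\ i)) survival_prob Q A i t A' *
      \sum_r mu r * potential (b' t r) (condition_on Q t) A' r =
    \sum_r mu r * \sum_t Q i t * \sum_(A' in powerset (A :\ i))
      survival_prob Q A i t A' * potential (b' t r) (condition_on Q t) A' r.
  under [RHS]eq_bigr do rewrite mulr_sumr.
  rewrite [RHS]exchange_big; apply: eq_bigr => t _.
  under [X in _ * X]eq_bigr do rewrite mulr_sumr.
  rewrite exchange_big mulr_sumr; apply: eq_bigr => r _.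
  rewrite mulrCA; congr (_ * _); rewrite mulr_sumr; apply: eq_bigr => A' _.
  by rewrite mulrCA.
rewrite -big_split; apply: ler_sum => r _; rewrite /= -mulrDr.
by apply: ler_wpM2l => //; apply: potential_step => //; apply: Q0.
Qed.
End UpperBound.

(** * Possible times of a task and occupation probabilities *)

Section Instances.

Variables (R : realType) (m n : nat) (I : instance R m n).

Lemma initial_law_bounds j u : initial_law I j u != 0 ->
  [/\ (a_ I j <= u.1)%N, (u.1 <= b_ I j)%N, (c_ I j <= u.2)%N
    & (u.2 <= d_ I j)%N].
Proof.
rewrite mulf_eq0 negb_or => /andP[su eu].
by split; [apply: min_slot_le | apply: le_max_slot
  | apply: min_slot_le | apply: le_max_slot]; rewrite inE.
Qed.

Lemma b_le_c j : (b_ I j <= c_ I j)%N.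
Proof. exact: start_le_end. Qed.

Lemma a_le_b j : (a_ I j <= b_ I j)%N.
Proof.
have [s sD] := distr_support_neq0 (start_distr I j).
exact: leq_trans (min_slot_le sD) (le_max_slot sD).
Qed.

Lemma c_le_d j : (c_ I j <= d_ I j)%N.
Proof.
have [e eD] := distr_support_neq0 (end_distr I j).
exact: leq_trans (min_slot_le eD) (le_max_slot eD).
Qed.

Lemma a_le_d j : (a_ I j <= d_ I j)%N.
Proof.
exact: leq_trans (a_le_b j) (leq_trans (b_le_c j) (c_le_d j)).
Qed.

Lemma d_lt j : (d_ I j < m)%N.
Proof.
(* The slot [e] witnesses that [m] is positive. *)
have [e _] := distr_support_neq0 (end_distr I j).
by apply: max_slot_lt; apply: leq_ltn_trans (ltn_ord e).
Qed.

Lemma Po_vacancy j r : 1 - Po I j r = vacancy_prob (initial_law I) r j.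
Proof. by rewrite vacancy_probE //; apply: initial_law_proper. Qed.

Lemma Po_compl_ge0 j r : 0 <= 1 - Po I j r.
Proof. by rewrite Po_vacancy vacancy_prob_ge0 //; apply: initial_law_proper. Qed.

(** The task starts by [b_ I j] and ends no earlier than [c_ I j], so it surely occupies [r]. *)
Lemma Po_between j (r : 'I_m) : (b_ I j <= r <= c_ I j)%N -> 1 - Po I j r = 0.
Proof.
move=> /andP[br rc]; rewrite Po_vacancy; apply: big1 => u.
apply: contraNeq => /initial_law_bounds[_ ub cu _].
by rewrite inE (leq_trans ub br) (leq_trans rc cu).
Qed.

Lemma Po_gt0 j u (r : 'I_m) :
  initial_law I j u != 0 -> r \in slots u -> 0 < Po I j r.
Proof.
have [Q0 _] := initial_law_proper I j.
move=> u0 ru; rewrite /Po /occupy_prob (bigD1 u) //= ltr_pwDl ?sumr_ge0 //.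
by rewrite lt_def u0 Q0.
Qed.

Lemma Po_gt0_bounds j (r : 'I_m) :
  0 < Po I j r -> (a_ I j <= r <= d_ I j)%N.
Proof.
have [Q0 _] := initial_law_proper I j.
move=> r0; apply: contraTT r0 => rad; rewrite -leNgt le_eqVlt; apply/orP; left.
rewrite /Po /occupy_prob big1 // => u.
rewrite inE => /andP[sr re]; apply: contraNeq rad.
move=> /initial_law_bounds[au _ _ ud].
by rewrite (leq_trans au sr) (leq_trans re ud).
Qed.

(** A span consists of the start range, the end range and the slots strictly between them, where the
    vacancy is 0. Double counting is harmless, as the terms are nonnegative. *)
Lemma potential_initial (r : 'I_m) :
  potential I true (initial_law I) [set: 'I_n] r <=
  1 + \sum_(i < n | (a_ I i <= r <= b_ I i)%N) (1 - Po I i r)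
    + \sum_(i < n | (c_ I i <= r <= d_ I i)%N) (1 - Po I i r).
Proof.
rewrite /potential -addrA lerD2l.
rewrite [leRHS]addrC [X in _ <= X + _]big_mkcond [X in _ <= _ + X]big_mkcond.
rewrite -big_split [leLHS]big_mkcond; apply: ler_sum => i _ /=.
rewrite inE -Po_vacancy; have P0 := Po_compl_ge0 i r; have P1 := @Po_between i r.
case: (leqP (a_ I i) r) => ar; case: (leqP r (d_ I i)) => rd;
  case: (leqP r (b_ I i)) P1 => rb; case: (leqP (c_ I i) r) => cr P1 //=;
  rewrite ?addr0 ?add0r ?lerDl //.
by rewrite P1 // (ltnW rb) (ltnW cr).
Qed.

(** * Policies giving priority to a set of tasks *)

(** A policy must commit some task whenever one is available, so tasks outside [S] serve as a
    fallback. *)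
Definition priority_task (S A : {set 'I_n}) : option 'I_n :=
  if [pick i in S :&: A] is Some i then Some i else [pick i in A].

Lemma priority_task_mem S A i : priority_task S A = Some i -> i \in A.
Proof.
rewrite /priority_task; case: pickP => [j|_].
  by rewrite inE => /andP[_ jA] [<-].
by case: pickP => // j jA [<-].
Qed.

Lemma priority_task_exists S A :
  A != finset.set0 -> exists i, priority_task S A = Some i.
Proof.
move=> /set0Pn[j jA]; rewrite /priority_task; case: pickP => [i _|_].
  by exists i.
by case: pickP => [i _|/(_ j)]; [exists i | rewrite jA].
Qed.

Lemma priority_task_first S A i :
  i \in S :&: A -> exists2 j, priority_task S A = Some j & j \in S :&: A.
Proof.
rewrite /priority_task; case: pickP => [j jSA _|/(_ i) -> //].
by exists j.
Qed.

Definition priority_prob (S : {set 'I_n}) (h : seq (round m n))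
    (A : {set 'I_n}) (i : 'I_n) : R := (priority_task S A == Some i)%:R.

Lemma sum_priority_prob S h (A : {set 'I_n}) (F : 'I_n -> R) i :
  priority_task S A = Some i -> \sum_(j in A) priority_prob S h A j * F j = F i.
Proof.
move=> Si; have iA := priority_task_mem Si; rewrite (bigD1 i) //= big1 => [|j].
  by rewrite /priority_prob Si eqxx mul1r addr0.
move=> /andP[_ /negPf ij].
by rewrite /priority_prob Si (inj_eq Some_inj) eq_sym ij mul0r.
Qed.

Fact priority_prob_ge0 S h A i : 0 <= priority_prob S h A i.
Proof. exact: ler0n. Qed.

Fact priority_prob_available S h (A : {set 'I_n}) i :
  i \notin A -> priority_prob S h A i = 0.
Proof.
move=> iA; rewrite /priority_prob; case: eqP => // /priority_task_mem.
by rewrite (negPf iA).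
Qed.

Fact priority_prob_sum1 S h (A : {set 'I_n}) :
  A != finset.set0 -> \sum_(i in A) priority_prob S h A i = 1.
Proof.
move=> /(priority_task_exists S)[i Si]; rewrite -(sum_priority_prob h (fun=> 1) Si).
by apply: eq_bigr => j _; rewrite mulr1.
Qed.

Definition priority_policy (S : {set 'I_n}) : policy R m n :=
  Policy (priority_prob_ge0 S) (@priority_prob_available S)
    (@priority_prob_sum1 S).

Definition disjoint_spans (S : {set 'I_n}) : bool :=
  [forall i in S, forall j in S,
     (i != j) ==> ((d_ I i < a_ I j) || (d_ I j < a_ I i))%N].

Lemma disjoint_spansP (S : {set 'I_n}) :
  reflect {in S &, forall i j, i != j -> (d_ I i < a_ I j) || (d_ I j < a_ I i)}%N
    (disjoint_spans S).
Proof.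
apply: (iffP forall_inP) => [dS i j iS jS ij|dS i iS].
  by have /forall_inP/(_ _ jS)/implyP/(_ ij) := dS _ iS.
by apply/forall_inP => j jS; apply/implyP; apply: dS.
Qed.

(** The times [t] stay within the span of [i], and the slots that [j] may occupy lie within its own
    span. *)
Lemma disjoint_no_conflict i j t :
  (d_ I i < a_ I j)%N || (d_ I j < a_ I i)%N -> initial_law I i t != 0 ->
  ~~ possible_conflict I t j.
Proof.
move=> dij /initial_law_bounds[a_t _ _ t_d]; apply/existsP => -[k /andP[]].
rewrite inE => /andP[tk kt] /Po_gt0_bounds/andP[ak kd].
case/orP: dij; rewrite ltnNge => /negP; apply.
  exact: leq_trans ak (leq_trans kt t_d).
exact: leq_trans a_t (leq_trans tk kd).
Qed.

Lemma cdsrse_gain_ge0 (pi : policy R m n) k h A : 0 <= cdsrse_gain I pi k h A.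
Proof.
elim: k h A => //= k IH h A; apply: sumr_ge0 => i _; apply: mulr_ge0.
  exact: commit_prob_ge0.
rewrite addr_ge0 ?weight_ge0 //; apply: sumr_ge0 => t _; apply: mulr_ge0 => //.
by have [] := initial_law_proper I i.
Qed.

(** Committing a task of [S] deletes no other task of [S], so each round collects one of them until
    none is left. *)
Lemma cdsrse_gain_priority S k h (A : {set 'I_n}) :
  disjoint_spans S -> (#|S :&: A| <= k)%N ->
  \sum_(i in S :&: A) weight I i <= cdsrse_gain I (priority_policy S) k h A.
Proof.
move=> /disjoint_spansP dS.
elim: k h A => [|k IH] h A SA.
  by move: SA; rewrite leqn0 cards_eq0 => /eqP ->; rewrite big_set0.
have [->|/set0Pn[l lSA]] := eqVneq (S :&: A) finset.set0.
  by rewrite big_set0 cdsrse_gain_ge0.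
have [i Si iSA] := priority_task_first lSA.
rewrite /= (sum_priority_prob _ _ Si) (bigD1 i) //= lerD2l.
have [Q0 Q1] := initial_law_proper I i.
(* The remaining weight does not depend on [t], so it can be averaged over the law of [i]. *)
rewrite -[leLHS]mul1r -Q1 mulr_suml; apply: ler_sum => t _.
have [->|t0] := eqVneq (initial_law I i t) 0; first by rewrite !mul0r.
apply: ler_wpM2l => //; set A' := [set j in _ | _].
have SA' : S :&: A' = (S :&: A) :\ i.
  apply/setP => j; rewrite !inE; case: eqP => [->|/eqP ji]; rewrite ?andbF //=.
  case jS: (j \in S) => //=; rewrite (@disjoint_no_conflict i) ?andbT //.
  by apply: dS; rewrite // 1?eq_sym //; move: iSA; rewrite inE => /andP[].
have <- : \sum_(j in S :&: A') weight I j =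
    \sum_(j in S :&: A | j != i) weight I j.
  by rewrite SA'; apply: eq_bigl => j; rewrite !inE andbC.
by apply: IH; move: SA; rewrite SA' (cardsD1 i (S :&: A)) iSA.
Qed.

(** * Simulation of CDSRSE policies in DSRSE *)

(** Conflicting times of nonzero probability would give the shared slot a positive occupation
    probability. *)
Lemma no_possible_conflict_prob t j :
  ~~ possible_conflict I t j -> conflict_prob (initial_law I) t j = 0.
Proof.
move=> tj; apply: big1 => u /pred0Pn[k /andP[/= kt ku]].
by apply: contraNeq tj => u0; apply/existsP; exists k; rewrite kt (Po_gt0 u0).
Qed.

Lemma condition_on_id (Q : joint_law R m n) t j :
  proper_law Q j -> conflict_prob Q t j = 0 -> condition_on Q t j =1 Q j.
Proof.
case=> Q0 _ p0 u; rewrite /condition_on p0 subr0 divr1; case: ifP => // tu.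
by move/psumr_eq0P: p0 => ->.
Qed.

Lemma dsrse_gain_ge0 (pi' : policy R m n) k h (A : {set 'I_n}) Q :
  (forall j, j \in A -> proper_law Q j) -> 0 <= dsrse_gain I pi' k h A Q.
Proof.
elim: k h A Q => //= k IH h A Q QA; apply: sumr_ge0 => i iA; apply: mulr_ge0.
  exact: commit_prob_ge0.
rewrite addr_ge0 ?weight_ge0 //; apply: sumr_ge0 => t _; apply: mulr_ge0.
  by have [] := QA _ iA.
apply: sumr_ge0 => A' sA'; have [->|s0] := eqVneq (survival_prob Q A i t A') 0.
  by rewrite mul0r.
apply: mulr_ge0; first exact: survival_prob_ge0.
by apply: IH => j; apply: survival_prob_proper sA' s0.
Qed.

(* The state consists of the history and of the available tasks of the CDSRSE
   process in which the same tasks are committed with the same times. *)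
Definition sim_step (s : seq (round m n) * {set 'I_n}) (x : round m n) :=
  (rcons s.1 (s.2, x.1.2, x.2),
   [set j in s.2 :\ x.1.2 | ~~ possible_conflict I x.2 j]).

Definition sim_state (h : seq (round m n)) :=
  foldl sim_step ([::], [set: 'I_n]) h.

Lemma sim_state_rcons h x : sim_state (rcons h x) = sim_step (sim_state h) x.
Proof. by rewrite /sim_state -cats1 foldl_cat. Qed.

Section Simulation.

Variable pi : policy R m n.

(* Once the simulated process is over, the choice no longer matters. *)
Definition sim_prob (h : seq (round m n)) (A : {set 'I_n}) (i : 'I_n) : R :=
  let s := sim_state h in
  if (s.2 != finset.set0) && (s.2 \subset A) then commit_prob pi s.1 s.2 i
  else priority_prob finset.set0 h A i.

Fact sim_prob_ge0 h A i : 0 <= sim_prob h A i.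
Proof.
by rewrite /sim_prob; case: ifP; rewrite ?commit_prob_ge0 ?priority_prob_ge0.
Qed.

Fact sim_prob_available h (A : {set 'I_n}) i : i \notin A -> sim_prob h A i = 0.
Proof.
move=> iA; rewrite /sim_prob; case: ifP => [/andP[_ sA]|_].
  by apply: commit_prob_available; apply: contra iA; apply: (subsetP sA).
exact: priority_prob_available.
Qed.

Fact sim_prob_sum1 h (A : {set 'I_n}) :
  A != finset.set0 -> \sum_(i in A) sim_prob h A i = 1.
Proof.
move=> A0; rewrite /sim_prob /=; case: andP => [[s0 sA]|_]; last first.
  exact: priority_prob_sum1.
rewrite -(commit_prob_sum1 pi (sim_state h).1 s0) (big_setID (sim_state h).2) /=.
rewrite (setIidPr sA) [X in _ + X]big1 ?addr0 // => i; rewrite inE => /andP[i0 _].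
exact: commit_prob_available.
Qed.

Definition sim_policy : policy R m n :=
  Policy sim_prob_ge0 sim_prob_available sim_prob_sum1.

(** Invariant: the tasks available in the simulated process are available in DSRSE with their
    initial laws. Those that CDSRSE keeps have conflict probability 0, so they survive and their
    laws do not change. *)
Lemma cdsrse_le_dsrse k h (A : {set 'I_n}) Q :
  (sim_state h).2 \subset A -> (forall j, j \in A -> proper_law Q j) ->
  (forall j, j \in (sim_state h).2 -> Q j =1 initial_law I j) ->
  cdsrse_gain I pi k (sim_state h).1 (sim_state h).2 <=
    dsrse_gain I sim_policy k h A Q.
Proof.
elim: k h A Q => [//|k IH] h A Q sA QA Qinit.
(* A finished simulation gains nothing more, while the DSRSE gain is nonnegative. *)
have [s0|s0] := eqVneq (sim_state h).2 finset.set0.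
  apply: le_trans (dsrse_gain_ge0 sim_policy k.+1 h QA).
  by rewrite s0 /= big_set0.
(* Tasks available only in DSRSE are committed with probability 0 while the simulation runs. *)
rewrite /= [leRHS](big_setID (sim_state h).2) /= (setIidPr sA) -[leLHS]addr0.
apply: lerD; last first.
  apply: sumr_ge0 => i; rewrite inE => /andP[is_ _].
  by rewrite /sim_prob s0 sA /= commit_prob_available ?mul0r.
apply: ler_sum => i is_; rewrite {1}/sim_prob s0 sA /=.
have iA := subsetP sA _ is_.
apply: ler_wpM2l; first exact: commit_prob_ge0.
rewrite lerD2l; apply: ler_sum => t _; rewrite Qinit //.
apply: ler_wpM2l; first by have [] := initial_law_proper I i.
(* The CDSRSE continuation does not depend on [A'], so it is averaged over the survival outcomes. *)
rewrite -[leLHS]mul1r -(sum_survival_prob Q A i t) mulr_suml.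
apply: ler_sum => A' sA'; have [->|t0] := eqVneq (survival_prob Q A i t A') 0.
  by rewrite !mul0r.
apply: ler_wpM2l; first exact: survival_prob_ge0.
have := IH (rcons h (A, i, t)) A' (condition_on Q t).
rewrite sim_state_rcons /=; set Ac := [set j in _ | _] => {}IH.
have conf j : j \in Ac -> [/\ j \in (sim_state h).2, j \in A :\ i
    & conflict_prob Q t j = 0].
  rewrite !inE => /andP[/andP[-> js] tj]; split=> //; first exact: subsetP js.
  rewrite -(no_possible_conflict_prob tj); apply: eq_bigr => u _.
  exact: Qinit.
apply: IH => [|j|j /conf[js jA pj] u].
- by apply/subsetP => j /conf[_ jA pj]; apply: survival_prob_certain t0 jA pj.
- exact: survival_prob_proper sA' t0.
- rewrite condition_on_id ?Qinit //; apply: QA; exact: subsetP js.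
Qed.

End Simulation.

End Instances.

(** * Packings of spans and the linear program *)

Section LowerBound.

Variables (R : realType) (m n : nat) (I : instance R m n).

Definition span_packing (r : nat) (S : {set 'I_n}) : bool :=
  disjoint_spans I S && [forall i in S, (d_ I i < r)%N].

Definition best_packing (r : nat) : {set 'I_n} :=
  [arg max_(S > finset.set0 | span_packing r S) \sum_(i in S) weight I i]%O.

Definition packing_value (r : nat) : R := \sum_(i in best_packing r) weight I i.

Lemma best_packingP r :
  span_packing r (best_packing r) /\
  forall S, span_packing r S -> \sum_(i in S) weight I i <= packing_value r.
Proof.
rewrite /packing_value /best_packing; case: arg_maxP => [|S] //.
apply/andP; split; last by apply/forall_inP => i; rewrite inE.
by apply/disjoint_spansP => i j; rewrite inE.
Qed.

Lemma packing_value_ge0 r : 0 <= packing_value r.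
Proof. by apply: sumr_ge0 => i _; apply: weight_ge0. Qed.

Lemma packing_value_le r r' : (r <= r')%N -> packing_value r <= packing_value r'.
Proof.
move=> rr'; have [/andP[dS /forall_inP Sr] _] := best_packingP r.
have [_ maxS] := best_packingP r'; apply: maxS; rewrite /span_packing dS /=.
by apply/forall_inP => i /Sr ir; apply: leq_trans ir rr'.
Qed.

(** Recursion of weighted interval scheduling: a best packing ending before [a_ I i] can be extended
    by [i]. *)
Lemma packing_value_add i :
  packing_value (a_ I i) + weight I i <= packing_value (d_ I i).+1.
Proof.
have [/andP[/disjoint_spansP dS /forall_inP Sa] _] := best_packingP (a_ I i).
have [_ maxS] := best_packingP (d_ I i).+1.
set S := best_packing (a_ I i) in dS Sa.
have iS : i \notin S by apply/negP => /Sa; rewrite ltnNge a_le_d.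
have -> : packing_value (a_ I i) + weight I i =
    \sum_(j in i |: S) weight I j by rewrite big_setU1 //= addrC.
apply: maxS; apply/andP; split.
  apply/disjoint_spansP => j k; rewrite !inE.
  move=> /predU1P[->|jS] /predU1P[->|kS]; rewrite ?eqxx //.
  - by rewrite (Sa _ kS) orbT.
  - by rewrite (Sa _ jS).
  - exact: dS.
apply/forall_inP => j; rewrite !inE ltnS => /predU1P[->//|/Sa ja].
by rewrite ltnW // (leq_trans ja) // a_le_d.
Qed.

(** Over the span of [i] the increments telescope, and [packing_value_add] bounds the difference
    from below. *)
Lemma packing_value_feasible :
  pes_feasible I (fun r : 'I_m => packing_value r.+1 - packing_value r).
Proof.
split=> [r|i]; first by rewrite subr_ge0 packing_value_le.
pose F r := packing_value r.+1 - packing_value r.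
rewrite -(big_mkord (fun r => (a_ I i <= r <= d_ I i)%N) F).
have -> : \sum_(0 <= r < m | (a_ I i <= r <= d_ I i)%N) F r =
    \sum_(a_ I i <= r < (d_ I i).+1) F r.
  rewrite (big_nat_widen (a_ I i) _ m) ?d_lt // (big_nat_widenl (a_ I i) 0) //.
  by apply: eq_bigl => r; rewrite /= ltnS andbC.
by rewrite telescope_sumr ?leqW ?a_le_d // lerBrDr addrC packing_value_add.
Qed.

Lemma pes_optimal_le_packing mu :
  pes_optimal I mu -> \sum_r mu r <= packing_value m.
Proof.
case=> _ /(_ _ packing_value_feasible) /le_trans; apply.
rewrite -(big_mkord xpredT (fun r => packing_value r.+1 - packing_value r)).
by rewrite telescope_sumr // gerBl packing_value_ge0.
Qed.

End LowerBound.

(** * Passage from single policies to the suprema *)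

Theorem mainTheorem5 (R : realType) (m n : nat) (I : instance R m n)
    (mu : 'I_m -> R) (hmu : pes_optimal I mu) :
  [/\ \sum_(r < m) mu r <= OPT_CDSRSE I,
      OPT_CDSRSE I <= OPT_DSRSE I
    & OPT_DSRSE I <=
        \sum_(r < m) mu r *
          (1 + \sum_(i < n | (a_ I i <= r <= b_ I i)%N) (1 - Po I i r)
             + \sum_(i < n | (c_ I i <= r <= d_ I i)%N) (1 - Po I i r))].
Proof.
set U := (X in OPT_DSRSE I <= X).
have dsrseU pi : dsrse_gain I pi n [::] [set: 'I_n] (initial_law I) <= U.
  have [[mu0 mu_cover] _] := hmu.
  apply: (le_trans (y := \sum_r
      mu r * potential I true (initial_law I) [set: 'I_n] r)).
    (* At the start every slot is unoccupied, so the flag is constantly true. *)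
    apply: (@dsrse_gain_le _ _ _ I mu pi n _ _ _ _ (fun=> true)) => // j _.
    exact: initial_law_proper.
  by apply: ler_sum => r _; apply: ler_wpM2l; rewrite ?potential_initial.
have dsrse_ub pi :
    dsrse_gain I pi n [::] [set: 'I_n] (initial_law I) <= OPT_DSRSE I.
  (* The supremum dominates its members only for a bounded set; [U] bounds the gain of every
     policy. *)
  apply: ub_le_sup; last by exists pi.
  by exists U => _ [pi' _ <-].
have cdsrse_dsrse pi : cdsrse_gain I pi n [::] [set: 'I_n] <= OPT_DSRSE I.
  apply: le_trans (dsrse_ub (sim_policy I pi)).
  apply: (@cdsrse_le_dsrse _ _ _ I pi n [::]) => // j _.
  exact: initial_law_proper.
split.
- apply: le_trans (pes_optimal_le_packing hmu) _.
  have [/andP[dS _] _] := best_packingP I m.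
  apply: (le_trans (y := cdsrse_gain I
    (priority_policy R m (best_packing I m)) n [::] [set: 'I_n])).
    have := @cdsrse_gain_priority _ _ _ I _ n [::] [set: 'I_n] dS.
    (* A packing has at most [n] tasks, so [n] rounds suffice. *)
    rewrite setIT; apply; apply: leq_trans (max_card _) _.
    by rewrite card_ord.
  apply: ub_le_sup; last by eexists.
  by exists (OPT_DSRSE I) => _ [pi _ <-].
- apply: ge_sup; last by move=> _ [pi _ <-].
  (* Any policy witnesses that the set of gains is nonempty. *)
  by eexists; exists (priority_policy R m finset.set0).
- apply: ge_sup; last by move=> _ [pi _ <-].
  by eexists; exists (priority_policy R m finset.set0).
Qed.
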